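(* Let $K$ be an infinite field and let $P=(p_1,\ldots,p_t)$, $p_1\ge\cdots\ge p_t\ge1$, be a partition of a positive integer $n$. The following are equivalent. (i) The parts of $P$ differ pairwise by at least two: $p_u-p_{u+1}\ge2$ for $1\le u\le t-1$. (ii) $Q(P)=P$. (iii) For some positive integer $c$, $Q(cP)=(cp_1,cp_2,\ldots,cp_t)$.
   Context: $J_P$ denotes the $n\times n$ nilpotent matrix in Jordan form with block sizes the parts of $P$. For a nilpotent matrix $B$, $\mathcal N_B$ denotes the set of nilpotent matrices over $K$ commuting with $B$; it is an irreducible algebraic variety. For $B=J_P$, $Q(P)$ denotes the partition given by the Jordan block sizes of a generic element of $\mathcal N_B$, i.e. of every element of some dense Zariski-open subset of $\mathcal N_B$. For a positive integer $c$, $cP$ denotes the partition of $cn$ obtained by repeating each part of $P$ exactly $c$ times (e.g. $P=(3,1,1)$ gives $2P=(3,3,1,1,1,1)$). *)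

(* Defs.v *)
From mathcomp Require Import all_boot all_order all_algebra.
From mathcomp Require Import mpoly.

Set Implicit Arguments.
Unset Strict Implicit.
Unset Printing Implicit Defensive.

Import GRing.Theory.
Local Open Scope ring_scope.

Definition is_partition_of (n : nat) (P : seq nat) : Prop :=
  [/\ sorted geq P, all (leq 1) P & sumn P = n].

Definition repeat_parts (c : nat) (P : seq nat) : seq nat :=
  flatten [seq nseq c p | p <- P].

Definition infinite_type (T : eqType) : Prop :=
  forall s : seq T, exists x : T, x \notin s.

Definition jordan_block (K : fieldType) (m : nat) : 'M[K]_m :=
  \matrix_(i < m, j < m) (j == i.+1 :> nat)%:R.

Fixpoint jordan_mx (K : fieldType) (P : seq nat) : 'M[K]_(sumn P) :=
  match P with
  | [::] => 0
  | m :: P' => block_mx (jordan_block K m) 0 0 (jordan_mx K P')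
  end.

Definition has_jordan_type (K : fieldType) (n : nat) (A : 'M[K]_n)
    (Q : seq nat) : Prop :=
  is_partition_of n Q /\
  exists e : sumn Q = n,
    similar_in unitmx A (castmx (e, e) (jordan_mx K Q)).

Definition nilpotent_mx (K : fieldType) (n : nat) (A : 'M[K]_n) : Prop :=
  exists k : nat, A ^+ k = 0.

Definition nilpotent_commutator (K : fieldType) (n : nat) (B : 'M[K]_n)
    (A : 'M[K]_n) : Prop :=
  nilpotent_mx A /\ comm_mx A B.

(* Polynomials in n * n variables are evaluated at the entries of A listed in
   the order of mxvec. *)
Definition entries_eval (K : fieldType) (n : nat) (f : {mpoly K[n * n]})
    (A : 'M[K]_n) : K :=
  f.@[fun k => mxvec A 0 k].

Definition zariski_closed (K : fieldType) (n : nat) (Z : 'M[K]_n -> Prop)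
    : Prop :=
  exists S : {mpoly K[n * n]} -> Prop,
    forall A, Z A <-> (forall f, S f -> entries_eval f A = 0).

Definition zariski_open_in (K : fieldType) (n : nat) (N U : 'M[K]_n -> Prop)
    : Prop :=
  exists2 Z, zariski_closed Z & forall A, U A <-> N A /\ ~ Z A.

Definition zariski_dense_in (K : fieldType) (n : nat) (N U : 'M[K]_n -> Prop)
    : Prop :=
  forall V, zariski_open_in N V -> (exists A, V A) -> exists A, V A /\ U A.

(* Q(P) = R.  The function P |-> Q(P) is given by its graph; two dense open
   subsets of the nilpotent commutator always meet, so R is unique. *)
Definition Q_is (K : fieldType) (P R : seq nat) : Prop :=
  exists U : 'M[K]_(sumn P) -> Prop,
    [/\ zariski_open_in (nilpotent_commutator (jordan_mx K P)) U,
        zariski_dense_in (nilpotent_commutator (jordan_mx K P)) U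
      & forall A, U A -> has_jordan_type A R].

(* Main.v *)
Require Import Defs.
From mathcomp Require Import all_boot all_order all_algebra.
From mathcomp Require Import mpoly.
From mathcomp Require Import zify.
From Stdlib Require Import Classical.

Set Implicit Arguments.
Unset Strict Implicit.
Unset Printing Implicit Defensive.

Import GRing.Theory.
Local Open Scope ring_scope.

(** Everything is read off from ranks of powers.  A nilpotent matrix A is
    similar to the Jordan matrix with block sizes q_1 >= ... >= q_r as soon as
    rank (A ^+ k) = sum_i (q_i - k), truncated at 0, for every k
    ([jordan_form_of_ranks]), and rank (A ^+ k) is lower semicontinuous: near
    a given A0, in the Zariski topology, it can only grow
    ([rank_exp_lower_semicontinuous]).  Since
    the case c = 1 of the last condition is Q(P) = P, it suffices to derive
    the gaps from Q(cP) = (c p_1, ..., c p_t), and Q(P) = P from the gaps.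

    Necessity of the gaps.  Suppose two consecutive parts p, q have p - q <= 1.  The c
    blocks of size p and the c blocks of size q together form a Jordan matrix
    similar to J ^+ (2 * c), for J one Jordan block of size c * (p + q), and
    the c blocks of any other part r are similar to J' ^+ c for J' one block
    of size c * r.  The direct sum of J and all the J' therefore yields a
    nilpotent matrix commuting with the Jordan matrix of cP and having only
    t - 1 blocks ([commuting_nilpotent_merging]).  Its rank exceeds that of a
    matrix of type (c p_1, ..., c p_t), and its rank is a lower bound on a
    nonempty open set, which every dense subset meets.

    Sufficiency of the gaps.  Give the basis vector at offset a of block j (numbered from
    0, by decreasing size) the degree j + a.  If the parts differ by at least
    two, then every nilpotent matrix commuting with the Jordan matrix J_P
    strictly raises the degree ([nilpotent_commutator_raises_degree]).
    Conversely, raising the degree forces nilpotency, so the nilpotent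
    commutator is a linear space; over an infinite field, the nonvanishing
    locus in it of a polynomial is dense as soon as it is nonempty
    ([zariski_dense_nonvanishing]).  Moreover block j occupies the
    degrees from j to j + p_j - 1, and these intervals are nested; counting
    rows of degree below a suitable d and columns of degree at least d + k
    then bounds rank (A ^+ k) by rank (J_P ^+ k) for every A in
    the nilpotent commutator ([nilpotent_commutator_rank_le]).  Hence all
    these ranks agree on the open dense set where they are not below those of
    J_P, and there A has type P. *)

(** * Powers of intertwined and block diagonal matrices *)

Section Conjugation.

Variable K : fieldType.

Lemma expmx_block_diag m n (A : 'M[K]_m) (B : 'M[K]_n) k :
  block_mx A 0 0 B ^+ k = block_mx (A ^+ k) 0 0 (B ^+ k).
Proof.
elim: k => [|k IHk]; first by rewrite !expr0 -scalar_mx_block.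
by rewrite !exprS IHk -!mulmxE mulmx_block !mulmx0 !mul0mx !addr0 !add0r.
Qed.

Lemma intertwine_exp n (S A B : 'M[K]_n) k :
  S *m A = B *m S -> S *m A ^+ k = B ^+ k *m S.
Proof.
move=> SA; elim: k => [|k IHk]; first by rewrite !expr0 mulmx1 mul1mx.
by rewrite exprS -mulmxE mulmxA SA -mulmxA IHk mulmxA mulmxE -exprS.
Qed.

Lemma rank_intertwine_exp n (S A B : 'M[K]_n) k :
  S \in unitmx -> S *m A = B *m S -> \rank (A ^+ k) = \rank (B ^+ k).
Proof.
move=> uS SA; have fS : row_free S by rewrite row_free_unit.
rewrite -(mxrankMfree (B ^+ k) fS) -(intertwine_exp k SA).
by rewrite eqmxMfull ?row_full_unit.
Qed.

End Conjugation.

(** * The Jordan form of a nilpotent matrix from the ranks of its powers *)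

Section JordanForm.

Variable K : fieldType.

Lemma jordan_block_expE m k (i j : 'I_m) :
  (jordan_block K m ^+ k) i j = (j == (i + k)%N :> nat)%:R.
Proof.
elim: k i => [|k IHk] i; first by rewrite expr0 mxE addn0 eq_sym.
rewrite exprS -mulmxE mxE; have [lt_i1m | le_mi1] := ltnP i.+1 m.
  rewrite (bigD1 (Ordinal lt_i1m)) //= big1 => [|l /negPf neq_l].
    by rewrite mxE eqxx mul1r addr0 IHk /= addSnnS.
  by rewrite mxE -[_ == _ :> nat]/(l == Ordinal lt_i1m) neq_l mul0r.
rewrite big1 => [|l _]; last by rewrite mxE ltn_eqF ?mul0r ?(leq_trans _ le_mi1).
by rewrite ltn_eqF // -addSnnS (leq_trans _ (leq_addr _ _)) // (leq_trans _ le_mi1).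
Qed.

Lemma rank_jordan_block_exp m k : \rank (jordan_block K m ^+ k) = (m - k)%N.
Proof.
pose X : 'M[K]_(m, m - k) := \matrix_(i, l) (i == l :> nat)%:R.
pose Y : 'M[K]_(m - k, m) := \matrix_(l, j) (j == (l + k)%N :> nat)%:R.
have XtX : X^T *m X = 1%:M.
  apply/matrixP=> a b; have lt_am : (a < m)%N by have := ltn_ord a; lia.
  rewrite !mxE (bigD1 (Ordinal lt_am)) //= big1 => [|i /negPf neq_i].
    by rewrite !mxE eqxx mul1r addr0.
  by rewrite !mxE -[_ == a :> nat]/(i == Ordinal lt_am) neq_i mul0r.
have YYt : Y *m Y^T = 1%:M.
  apply/matrixP=> a b; have lt_am : (a + k < m)%N by have := ltn_ord a; lia.
  rewrite !mxE (bigD1 (Ordinal lt_am)) //= big1 => [|i /negPf neq_i].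
    by rewrite !mxE eqxx mul1r addr0 /= eqn_add2r.
  by rewrite !mxE -[_ == (a + k)%N :> nat]/(i == Ordinal lt_am) neq_i mul0r.
have defJ : jordan_block K m ^+ k = X *m Y.
  apply/matrixP=> i j; rewrite jordan_block_expE mxE.
  have [lt_i | le_i] := ltnP i (m - k).
    rewrite (bigD1 (Ordinal lt_i)) //= big1 => [|l neq_l].
      by rewrite !mxE eqxx mul1r addr0.
    rewrite !mxE; case: eqP => [eq_il|]; last by rewrite mul0r.
    by case/eqP: neq_l; apply: val_inj.
  rewrite big1 => [|l _]; last first.
    by rewrite !mxE; case: eqP; rewrite ?mul0r // => eq_il; have := ltn_ord l; lia.
  by case: eqP => // eq_j; have := ltn_ord j; lia.
apply/eqP; rewrite eqn_leq defJ (leq_trans (mxrankM_maxl _ _)) ?rank_leq_col //=.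
apply: (@mulmx1_min_rank _ _ _ _ _ X^T Y^T).
by rewrite mulmxA XtX mul1mx YYt.
Qed.

Lemma rank_jordan_mx_exp (P : seq nat) k :
  \rank (jordan_mx K P ^+ k) = sumn [seq (p - k)%N | p <- P].
Proof.
elim: P => [|p P IHP] /=; first by rewrite flatmx0 mxrank0.
by rewrite expmx_block_diag rank_diag_block_mx rank_jordan_block_exp IHP.
Qed.

(** A Jordan block of maximal size splits off.  With a nonzero entry (i, j) of
    A ^+ p, the rows e_i A^a span a cyclic subspace V and the columns A^b e_j
    cut out an invariant subspace W, their common left kernel.  The matrix of
    pairings e_i A^(a + b) e_j is triangular up to the order of its columns,
    with a nonzero constant diagonal, so V and W are complementary. *)
Lemma split_cyclic_block p m (A : 'M[K]_(p.+1 + m)) :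
    A ^+ p.+1 = 0 -> A ^+ p != 0 ->
  exists2 S, S \in unitmx &
    exists A' : 'M[K]_m, S *m A = block_mx (jordan_block K p.+1) 0 0 A' *m S.
Proof.
move=> Ap0 /matrix0Pn[i [j cn0]].
have A0 k : (p < k)%N -> A ^+ k = 0.
  by move=> lt_pk; rewrite -(subnKC lt_pk) exprD Ap0 mul0r.
pose V : 'M[K]_(p.+1, p.+1 + m) := \matrix_(a, x) (A ^+ a) i x.
(* Taking the exponents in decreasing order makes V *m C upper triangular. *)
pose C : 'M[K]_(p.+1 + m, p.+1) := \matrix_(x, b) (A ^+ (p - b)) x j.
have VC a b : (V *m C) a b = (A ^+ (a + (p - b))) i j.
  by rewrite exprD -mulmxE !mxE; apply: eq_bigr => x _; rewrite !mxE.
have uVC : V *m C \in unitmx.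
  rewrite unitmxE unitfE -det_tr det_trig.
    apply/prodf_neq0 => a _; rewrite mxE VC subnKC //.
    by rewrite -ltnS ltn_ord.
  apply/is_trig_mxP => a b lt_ab; rewrite mxE VC A0 ?mxE //.
  by have := ltn_ord b; lia.
have VA : V *m A = jordan_block K p.+1 *m V.
  apply/matrixP=> a x; transitivity ((A ^+ a.+1) i x).
    by rewrite exprSr -mulmxE !mxE; apply: eq_bigr => y _; rewrite !mxE.
  rewrite mxE; have [lt_a1 | le_a1] := ltnP a.+1 p.+1.
    rewrite (bigD1 (Ordinal lt_a1)) //= big1 => [|l /negPf neq_l].
      by rewrite !mxE eqxx mul1r addr0.
    by rewrite !mxE -[_ == _ :> nat]/(l == Ordinal lt_a1) neq_l mul0r.
  rewrite A0 // mxE big1 // => l _.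
  by rewrite mxE ltn_eqF ?mul0r // (leq_trans _ le_a1).
have AC : A *m C = C *m jordan_block K p.+1.
  apply/matrixP=> x b; transitivity ((A ^+ (p - b).+1) x j).
    by rewrite exprS -mulmxE !mxE; apply: eq_bigr => y _; rewrite !mxE.
  rewrite mxE; case: b => -[|b] lt_b /=.
    by rewrite A0 ?subn0 // mxE big1 // => l _; rewrite !mxE mulr0.
  rewrite (bigD1 (Ordinal (ltnW lt_b))) //= big1 => [|l neq_l].
    by rewrite !mxE eqxx mulr1 addr0 -subSn.
  rewrite !mxE /= eqSS; case: eqP => [eq_bl|]; last by rewrite mulr0.
  by case/eqP: neq_l; apply: val_inj.
have rkC : \rank C = p.+1.
  apply/eqP; rewrite eqn_leq rank_leq_col /= -{1}(mxrank_unit uVC).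
  exact: mxrankM_maxr.
have [W defW] : exists W : 'M[K]_(m, p.+1 + m), (W :=: kermx C)%MS.
  have rk : \rank (kermx C) = m by rewrite mxrank_ker rkC addKn.
  by move: (row_base _) (eq_row_base (kermx C)); rewrite rk => W; exists W.
have WC : W *m C = 0 by apply/sub_kermxP; rewrite defW.
have freeW : row_free W.
  by rewrite /row_free defW mxrank_ker rkC addKn.
have /submxP[A' WA] : (W *m A <= W)%MS.
  by rewrite defW; apply/sub_kermxP; rewrite -mulmxA AC mulmxA WC mul0mx.
exists (col_mx V W); last first.
  exists A'; rewrite mul_col_mx VA WA mul_block_col !mul0mx addr0 add0r //.
rewrite -row_free_unit -kermx_eq0; apply/rowV0P => x /sub_kermxP.
rewrite -[x]hsubmxK mul_row_col; set a := lsubmx x; set b := rsubmx x => x0.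
have a0 : a = 0.
  have := congr1 (mulmx^~ (C *m invmx (V *m C))) x0.
  rewrite /= mul0mx mulmxDl -mulmxA [V *m _]mulmxA mulmxV // mulmx1.
  by rewrite -mulmxA [W *m _]mulmxA WC mul0mx mulmx0 addr0.
move: x0; rewrite a0 mul0mx add0r => bW0.
suff -> : b = 0 by rewrite row_mx0.
by apply: (row_free_inj freeW); rewrite bW0 mul0mx.
Qed.

Lemma all_leq_sumn (s : seq nat) : all (geq (sumn s)) s.
Proof.
elim: s => //= p s IHs; rewrite leq_addr /=.
by apply: sub_all IHs => q /= le_q; apply: leq_trans le_q (leq_addl _ _).
Qed.

Lemma sumn_map_subn_eq0 k (P : seq nat) :
  all (geq k) P -> sumn [seq (p - k)%N | p <- P] = 0%N.
Proof. by elim: P => //= p P IHP /andP[le_pk /IHP ->]; rewrite addn0; apply/eqP. Qed.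

(** The vanishing of A ^+ p and the nonvanishing of A ^+ p.-1, for the largest
    part p, are rank conditions, so a block of size p splits off; the ranks
    for the complement follow by subtraction. *)
Lemma jordan_form_of_ranks (P : seq nat) (A : 'M[K]_(sumn P)) :
    sorted geq P -> all (leq 1) P ->
    (forall k, \rank (A ^+ k) = sumn [seq (p - k)%N | p <- P]) ->
  exists2 S, S \in unitmx & S *m A = jordan_mx K P *m S.
Proof.
elim: P A => [|[//|p] P IHP] A sP /=.
  by exists 1%:M; rewrite ?unitmx1 // mulmx1 mul1mx; apply: flatmx0.
move=> pos_P rkA.
have [||S uS [A' SA]] := @split_cyclic_block p (sumn P) A.
- apply/eqP; rewrite -mxrank_eq0 rkA subnn sumn_map_subn_eq0 //.
  by have := order_path_min (rev_trans leq_trans) sP.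
- by rewrite -mxrank_eq0 rkA subSnn.
have [||k|S' uS' SA'] := IHP A'.
- exact: path_sorted sP.
- exact: pos_P.
- apply: (@addnI (p.+1 - k)%N); rewrite -rkA (rank_intertwine_exp k uS SA).
  by rewrite expmx_block_diag rank_diag_block_mx rank_jordan_block_exp.
exists (block_mx 1%:M 0 0 S' *m S).
  rewrite unitmx_mul uS andbT unitmxE det_ublock det1 mul1r.
  exact: uS'.
rewrite -mulmxA SA !mulmxA; congr (_ *m _).
by rewrite !mulmx_block !mulmx0 !mul0mx !mulmx1 !mul1mx !addr0 !add0r SA'.
Qed.

End JordanForm.

(** * Merging almost equal blocks into one *)

Section CommutingPairs.

Variable K : fieldType.

(** The rank clause for C makes C similar to the Jordan matrix of Q when Q is
    decreasing, and the one for D says that D has at most t Jordan blocks.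
    Prescribing C only up to similarity is what makes these pairs add up under
    concatenation and lets a power of a single Jordan block serve as C. *)
Definition commuting_pair (Q : seq nat) (t : nat) : Prop :=
  exists D C : 'M[K]_(sumn Q),
    [/\ nilpotent_mx D, comm_mx D C, (sumn Q <= \rank D + t)%N
      & forall k, \rank (C ^+ k) = sumn [seq (q - k)%N | q <- Q]].

Lemma nilpotent_block_diag m n (A : 'M[K]_m) (B : 'M[K]_n) :
  nilpotent_mx A -> nilpotent_mx B -> nilpotent_mx (block_mx A 0 0 B).
Proof.
move=> [k Ak] [l Bl]; exists (k + l)%N.
by rewrite expmx_block_diag !exprD Ak Bl mul0r mulr0 block_mx0.
Qed.

Lemma commuting_pair_nil : commuting_pair [::] 0.
Proof.
exists 0, 0; split=> //; first by exists 1%N; rewrite expr1.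
by move=> k; rewrite /= flatmx0 mxrank0.
Qed.

Lemma commuting_pair_cat Q1 Q2 t1 t2 :
  commuting_pair Q1 t1 -> commuting_pair Q2 t2 ->
  commuting_pair (Q1 ++ Q2) (t1 + t2).
Proof.
move=> [D1 [C1 [nD1 cDC1 rD1 rC1]]] [D2 [C2 [nD2 cDC2 rD2 rC2]]].
rewrite /commuting_pair sumn_cat.
exists (block_mx D1 0 0 D2), (block_mx C1 0 0 C2); split.
- exact: nilpotent_block_diag.
- by rewrite /comm_mx !mulmx_block !mulmx0 !mul0mx !addr0 !add0r cDC1 cDC2.
- by rewrite rank_diag_block_mx; lia.
by move=> k; rewrite map_cat sumn_cat expmx_block_diag rank_diag_block_mx rC1 rC2.
Qed.

Lemma nilpotent_jordan_block m : nilpotent_mx (jordan_block K m).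
Proof.
by exists m; apply/eqP; rewrite -mxrank_eq0 rank_jordan_block_exp subnn.
Qed.

(** The (a + b)-th power of one Jordan block of size N has rank N - (a + b) k
    after raising it to the k, exactly as for a + b blocks whose sizes add up to
    N and differ by at most one. *)
Lemma commuting_pair_almost_rectangular a b p :
  commuting_pair (nseq a p.+1 ++ nseq b p) 1.
Proof.
set Q := _ ++ _; pose J := jordan_block K (sumn Q).
exists J, (J ^+ (a + b)); split.
- exact: nilpotent_jordan_block.
- by rewrite comm_mxE; apply: commrX.
- by rewrite -[J]expr1 rank_jordan_block_exp; lia.
move=> k; rewrite -exprM rank_jordan_block_exp /Q map_cat !map_nseq.
rewrite !sumn_cat !sumn_nseq; have [le_kp | lt_pk] := leqP k p; last first.
  have -> : (p.+1 - k = 0)%N by lia.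
  have -> : (p - k = 0)%N by lia.
  nia.
have -> : p = (k + (p - k))%N by lia.
by move: (p - k)%N => d; rewrite -addnS !addKn; nia.
Qed.

Lemma commuting_pair_nseq a p : commuting_pair (nseq a p) 1.
Proof. exact: (commuting_pair_almost_rectangular 0 a p). Qed.

Lemma repeat_parts_cat c P1 P2 :
  repeat_parts c (P1 ++ P2) = repeat_parts c P1 ++ repeat_parts c P2.
Proof. by rewrite /repeat_parts map_cat flatten_cat. Qed.

Lemma commuting_pair_repeat_parts c P :
  commuting_pair (repeat_parts c P) (size P).
Proof.
elim: P => [|p P IHP]; first exact: commuting_pair_nil.
exact: (commuting_pair_cat (commuting_pair_nseq c p) IHP).
Qed.

Lemma mem_repeat_parts c P p : p \in repeat_parts c P -> p \in P.
Proof.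
elim: P => //= q P IHP; rewrite mem_cat in_cons mem_nseq.
by case/orP=> [/andP[_ ->] // | /IHP ->]; rewrite orbT.
Qed.

Lemma sorted_repeat_parts c P : sorted geq P -> sorted geq (repeat_parts c P).
Proof.
have geq_trans : transitive geq := rev_trans leq_trans.
rewrite !(sorted_pairwise geq_trans); elim: P => //= p P IHP /andP[/allP geP sP].
rewrite [repeat_parts _ _]/= pairwise_cat IHP // andbT; apply/andP; split.
  apply/allrelP => x y; rewrite mem_nseq => /andP[_ /eqP ->].
  by move/mem_repeat_parts/geP.
rewrite -(sorted_pairwise geq_trans); case: (c) => //= b.
by elim: b => //= b ->; rewrite leqnn.
Qed.

Lemma commuting_nilpotent_of_pair Q t :
    sorted geq Q -> all (leq 1) Q -> commuting_pair Q t ->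
  exists2 A, nilpotent_commutator (jordan_mx K Q) A & (sumn Q <= \rank A + t)%N.
Proof.
move=> sQ posQ [D [C [[k Dk] cDC rD rC]]].
have [S uS SC] := jordan_form_of_ranks sQ posQ rC.
have [A SD] : exists A, S *m D = A *m S.
  by exists (S *m D *m invmx S); rewrite mulmxKV.
have SK (M N : 'M[K]_(sumn Q)) : M *m S = N *m S -> M = N.
  by apply/row_free_inj; rewrite row_free_unit.
exists A; last by have := rank_intertwine_exp 1 uS SD; rewrite !expr1 => <-.
split; first by exists k; apply: SK; rewrite -(intertwine_exp k SD) Dk mulmx0 mul0mx.
apply: SK; rewrite -!mulmxA -SC -SD !mulmxA -SD -SC -!mulmxA.
by rewrite cDC.
Qed.

Lemma commuting_nilpotent_merging c P u :
    is_partition_of (sumn P) P -> (0 < c)%N -> (u.+1 < size P)%N ->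
    (nth 0 P u - nth 0 P u.+1 < 2)%N ->
  exists2 A, nilpotent_commutator (jordan_mx K (repeat_parts c P)) A
    & (sumn (repeat_parts c P) < \rank A + size P)%N.
Proof.
move=> [sP posP _] c_gt0 lt_u1 small.
set p := nth 0%N P u; set q := nth 0%N P u.+1.
have defP : P = take u P ++ [:: p; q] ++ drop u.+2 P.
  rewrite /= -drop_nth // -drop_nth ?cat_take_drop //; exact: ltnW.
have le_qp : (q <= p)%N.
  by apply: (sorted_leq_nth (rev_trans leq_trans) leqnn 0%N sP);
    rewrite ?inE ?leqnSn ?(ltnW lt_u1).
have pair_pq : commuting_pair (nseq c p ++ nseq c q) 1.
  have [eq_pq | neq_pq] := eqVneq p q.
    by rewrite eq_pq -nseqD; apply: commuting_pair_nseq.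
  have -> : p = q.+1 by rewrite /p /q in le_qp neq_pq *; lia.
  exact: commuting_pair_almost_rectangular.
have /commuting_nilpotent_of_pair[||A NA rA] :
    commuting_pair (repeat_parts c P) (size P).-1.
- have -> : (size P).-1 = (size (take u P) + (1 + size (drop u.+2 P)))%N.
    by rewrite size_takel ?size_drop; lia.
  rewrite {1}defP !repeat_parts_cat; apply: commuting_pair_cat.
    exact: commuting_pair_repeat_parts.
  apply: commuting_pair_cat; last exact: commuting_pair_repeat_parts.
  by rewrite /repeat_parts /= cats0.
- exact: sorted_repeat_parts.
- by apply/allP => x /mem_repeat_parts; apply/allP.
by exists A => //; lia.
Qed.

End CommutingPairs.

(** * Zariski open sets and generic rank *)

Section Zariski.

Variable K : fieldType.

Lemma rank_factorization n (M : 'M[K]_n) :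
  exists X Y, X *m M *m Y = 1%:M :> 'M_(\rank M).
Proof.
exists (pid_mx (\rank M) *m invmx (col_ebase M)).
exists (invmx (row_ebase M) *m pid_mx (\rank M)).
have := congr1 (mulmx ((pid_mx (\rank M) : 'M_(\rank M, n)) *m invmx (col_ebase M)))
  (mulmx_ebase M).
rewrite !mulmxA mulmxKV ?col_ebase_unit // pid_mx_id ?rank_leq_row // => <-.
by rewrite mulmxK ?row_ebase_unit // pid_mx_id ?rank_leq_row ?pid_mx_1.
Qed.

(** If X (A0 ^+ k) Y is the identity of size rank (A0 ^+ k), the determinant
    of X (A ^+ k) Y is a polynomial in the entries of A that is nonzero at A0
    and bounds rank (A ^+ k) from below wherever it does not vanish. *)
Lemma rank_exp_lower_semicontinuous n (A0 : 'M[K]_n) k :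
  exists2 f, entries_eval f A0 != 0 &
    forall A, entries_eval f A != 0 -> (\rank (A0 ^+ k) <= \rank (A ^+ k))%N.
Proof.
have [X [Y XY]] := rank_factorization (A0 ^+ k).
(* The generic matrix, whose evaluation at the entries of A is A. *)
pose G : 'M[{mpoly K[n * n]}]_n := \matrix_(i, j) 'X_(mxvec_index i j).
pose cst m l (M : 'M[K]_(m, l)) := map_mx (@mpolyC (n * n) K) M.
pose f := \det (cst _ _ X *m G ^+ k *m cst _ _ Y).
have fE A : entries_eval f A = \det (X *m A ^+ k *m Y).
  rewrite /entries_eval /f -det_map_mx; congr (\det _); rewrite !map_mxM.
  set ev := (X in map_mx X (cst _ _ Y)).
  have cstK m l (M : 'M[K]_(m, l)) : map_mx ev (cst _ _ M) = M.
    by apply/matrixP => i j; rewrite !mxE; apply: mevalC.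
  rewrite !cstK; congr (_ *m _ *m _).
  elim: k {X Y XY f} => [|k IHk]; first by rewrite !expr0 map_mx1.
  rewrite !exprS -mulmxE map_mxM IHk -mulmxE; congr (_ *m _).
  by apply/matrixP => i j; rewrite !mxE -mxvecE; apply: mevalXU.
exists f => [|A]; first by rewrite fE XY det1 oner_eq0.
rewrite fE -unitfE -unitmxE => uXAY.
rewrite -{1}(mxrank_unit uXAY).
exact: leq_trans (mxrankM_maxl _ _) (mxrankM_maxr _ _).
Qed.

Lemma rank_exps_lower_semicontinuous n (A0 : 'M[K]_n) N :
  exists2 f, entries_eval f A0 != 0 &
    forall A, entries_eval f A != 0 ->
      forall k, (k < N)%N -> (\rank (A0 ^+ k) <= \rank (A ^+ k))%N.
Proof.
elim: N => [|N [f f0 fP]].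
  by exists 1; rewrite ?/entries_eval ?meval1 ?oner_eq0.
have [g g0 gP] := rank_exp_lower_semicontinuous A0 N.
have fgM A : entries_eval (f * g) A = entries_eval f A * entries_eval g A.
  exact: mevalM.
exists (f * g) => [|A]; first by rewrite fgM mulf_neq0.
rewrite fgM mulf_eq0 => /norP[fA gA] k.
rewrite ltnS leq_eqVlt => /predU1P[-> | ]; first exact: gP.
exact: fP.
Qed.

Lemma entries_eval_line n (f : {mpoly K[n * n]}) (A B : 'M[K]_n) :
  exists F : {poly K}, forall s, F.[s] = entries_eval f (A + s *: B).
Proof.
exists (\sum_(m <- msupp f) f@_m *:
  \prod_i ((mxvec A 0 i)%:P + mxvec B 0 i *: 'X) ^+ m i) => s.
rewrite /entries_eval mevalE horner_sum; apply: eq_bigr => m _.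
rewrite hornerZ horner_prod; congr (_ * _); apply: eq_bigr => i _.
by rewrite horner_exp hornerD hornerC hornerZ hornerX linearD linearZ !mxE mulrC.
Qed.

Lemma nonroot_exists (F : {poly K}) :
  infinite_type K -> F != 0 -> exists s, F.[s] != 0.
Proof.
move=> infK nzF.
have [rs [us sz_rs]] : exists rs : seq K, uniq rs /\ size rs = size F.
  elim: (size F) => [|N [rs [us sz]]]; first by exists [::].
  by have [x x_rs] := infK rs; exists (x :: rs); rewrite /= x_rs us sz.
have [all_rs | ] := boolP (all (root F) rs); last by case/allPn=> s _; exists s.
by have := max_poly_roots nzF all_rs us; rewrite sz_rs ltnn.
Qed.

Lemma zariski_open_nonvanishing n (N : 'M[K]_n -> Prop) f :
  zariski_open_in N (fun A => N A /\ entries_eval f A != 0).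
Proof.
exists (fun A => entries_eval f A = 0).
  by exists (eq f) => A; split=> [fA _ <- // | ]; apply.
by move=> A; split=> -[NA fA]; split=> //; apply/eqP.
Qed.

(** For irreducible varieties this is the fact that nonempty open sets are
    dense.  Here N contains the line through any two of its points; along the
    line from A to B, a polynomial nonzero at A and one nonzero at B restrict
    to nonzero univariate polynomials, whose product has a nonroot. *)
Lemma zariski_dense_nonvanishing n (N : 'M[K]_n -> Prop) f B :
    infinite_type K ->
    (forall A B s, N A -> N B -> N (A + s *: (B - A))) ->
    N B -> entries_eval f B != 0 ->
  zariski_dense_in N (fun A => N A /\ entries_eval f A != 0).
Proof.
move=> infK linN NB fB V [Z [S defZ] defV] [A /defV[NA nZA]].
have [g Sg gA] : exists2 g, S g & entries_eval g A != 0.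
  apply: NNPP => no_g; apply: nZA; apply/defZ => g Sg.
  by apply/eqP; apply: contra_notT no_g => gA; exists g.
have [F defF] := entries_eval_line f A (B - A).
have [G defG] := entries_eval_line g A (B - A).
have nzF : F != 0.
  apply: contraNneq fB => F0; have := defF 1.
  by rewrite F0 horner0 scale1r addrC subrK => <-.
have nzG : G != 0.
  by apply: contraNneq gA => G0; have := defG 0; rewrite G0 horner0 scale0r addr0 => <-.
have [s] := nonroot_exists infK (mulf_neq0 nzF nzG).
rewrite hornerM mulf_eq0 defF defG => /norP[fs gs].
exists (A + s *: (B - A)); have Ns := linN _ _ s NA NB.
by split=> //; apply/defV; split=> // /defZ/(_ g Sg)/eqP; apply/negP.
Qed.

Lemma Q_is_witness Q R f A0 :
    Q_is K Q R -> nilpotent_commutator (jordan_mx K Q) A0 ->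
    entries_eval f A0 != 0 ->
  exists2 A, entries_eval f A != 0 & has_jordan_type A R.
Proof.
move=> [U [_ denseU jordU]] NA0 fA0.
have [|A [[_ fA] /jordU]] := denseU _ (zariski_open_nonvanishing _ f).
  by exists A0.
by exists A.
Qed.

Lemma rank_of_jordan_type n (A : 'M[K]_n) R :
  has_jordan_type A R -> (\rank A + size R = n)%N.
Proof.
case=> -[_ posR _] [e]; case: n / e A => A; rewrite castmx_id.
case=> S uS /(similarP uS) SA.
have := rank_intertwine_exp 1 uS SA; rewrite !expr1 => ->.
rewrite -[jordan_mx K R]expr1 rank_jordan_mx_exp.
by elim: R posR {A S uS SA} => //= p R IHR /andP[p_gt0 /IHR]; lia.
Qed.

(** Two parts closer than two can be merged, which yields a rank that is too
    large on a nonempty open subset of the nilpotent commutator; comparing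
    ranks of first powers, that is, numbers of blocks, suffices. *)
Lemma parts_differ_of_Q_is c P :
    is_partition_of (sumn P) P -> (0 < c)%N ->
    Q_is K (repeat_parts c P) [seq (c * p)%N | p <- P] ->
  forall u, (u.+1 < size P)%N -> (2 <= nth 0 P u - nth 0 P u.+1)%N.
Proof.
move=> partP c_gt0 QcP u lt_u1; rewrite leqNgt; apply/negP => small.
have [A0 NA0 rA0] := commuting_nilpotent_merging K partP c_gt0 lt_u1 small.
have [f fA0 fP] := rank_exp_lower_semicontinuous A0 1.
have [A /fP] := Q_is_witness QcP NA0 fA0.
rewrite !expr1 => le_rank /rank_of_jordan_type; rewrite size_map; lia.
Qed.

End Zariski.

(** * Block and offset of a basis vector *)

Section BlockCoordinates.

Variable P : seq nat.

Local Notation block u := (reshape_index P u).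
Local Notation offset u := (reshape_offset P u).

Lemma reshape_index_cons_lt p Q i :
  (i < p)%N -> reshape_index (p :: Q) i = 0%N.
Proof. by rewrite /reshape_index /= subn_eq0 => ->. Qed.

Lemma reshape_index_cons_add p Q i :
  reshape_index (p :: Q) (p + i) = (reshape_index Q i).+1.
Proof.
by rewrite /reshape_index /= subn_eq0 ltnNge leq_addr /= -addnS addKn.
Qed.

Lemma reshape_offset_cons_lt p Q i :
  (i < p)%N -> reshape_offset (p :: Q) i = i.
Proof.
by move=> lt_ip; rewrite /reshape_offset reshape_index_cons_lt //= subn0.
Qed.

Lemma reshape_offset_cons_add p Q i :
  reshape_offset (p :: Q) (p + i) = reshape_offset Q i.
Proof. by rewrite /reshape_offset reshape_index_cons_add /= subnDl. Qed.

Definition reshape_consE :=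
  (reshape_index_cons_add, reshape_offset_cons_add).

Lemma sum_block_offset (F : nat -> nat -> nat) :
  (\sum_(u < sumn P) F (block u) (offset u) =
   \sum_(j < size P) \sum_(a < nth 0 P j) F j a)%N.
Proof.
elim: P F => [|p Q IHQ] F; first by rewrite !big_ord0.
rewrite big_split_ord big_ord_recl /=; congr (_ + _)%N.
  apply: eq_bigr => u _.
  by rewrite reshape_index_cons_lt ?reshape_offset_cons_lt.
by rewrite -(IHQ (fun j => F j.+1)); apply: eq_bigr => u _; rewrite !reshape_consE.
Qed.

Lemma block_offset_inj (u v : 'I_(sumn P)) :
  block u = block v -> offset u = offset v -> u = v.
Proof.
move=> eq_b eq_o; apply: val_inj.
by rewrite /= -(reshape_indexK P u) eq_b eq_o reshape_indexK.
Qed.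

Lemma block_offset_ex j a : (a < nth 0 P j)%N ->
  exists u : 'I_(sumn P), block u = j /\ offset u = a.
Proof.
move=> lt_a; exists (Ordinal (flatten_indexP lt_a)).
by rewrite /= flatten_indexKl ?flatten_indexKr.
Qed.

End BlockCoordinates.

(** * Supports of matrices commuting with a Jordan matrix *)

Section JordanCommutator.

Variables (K : fieldType) (P : seq nat).
Implicit Types u v w : 'I_(sumn P).

Local Notation block u := (reshape_index P u).
Local Notation offset u := (reshape_offset P u).

Definition next_in_block (u v : 'I_(sumn P)) :=
  (block v == block u) && (offset v == (offset u).+1).

Lemma jordan_mxE u v : jordan_mx K P u v = (next_in_block u v)%:R.
Proof.
rewrite /next_in_block; elim: P u v => [|p Q IHQ] u v; first by case: u.
rewrite -(splitK u) -(splitK v); case: (split u) (split v) => i [] j /=.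
- by rewrite block_mxEul mxE !reshape_index_cons_lt // !reshape_offset_cons_lt.
- rewrite block_mxEur mxE reshape_index_cons_add reshape_index_cons_lt //.
- rewrite block_mxEdl mxE reshape_index_cons_add reshape_index_cons_lt //.
- by rewrite block_mxEdr IHQ !reshape_consE eqSS.
Qed.

Lemma next_exists u : ((offset u).+1 < nth 0 P (block u))%N ->
  exists v, next_in_block u v.
Proof.
by case/block_offset_ex=> v [bv ov]; exists v; rewrite /next_in_block bv ov !eqxx.
Qed.

Lemma prev_exists v : (0 < offset v)%N -> exists u, next_in_block u v.
Proof.
move=> o_gt0; have [|u [bu ou]] := @block_offset_ex P (block v) (offset v).-1.
  by have := reshape_offsetP (ltn_ord v); lia.
by exists u; rewrite /next_in_block bu ou prednK ?eqxx.
Qed.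

Variable A : 'M[K]_(sumn P).

Lemma mulmx_jordan_next w u v :
  next_in_block u v -> (A *m jordan_mx K P) w v = A w u.
Proof.
move=> uv; rewrite mxE (bigD1 u) //= big1 => [|z neq_z].
  by rewrite jordan_mxE uv mulr1 addr0.
rewrite jordan_mxE; have [/andP[/eqP bu /eqP ou]] := (uv).
case: (boolP (next_in_block z v)) => [/andP[/eqP bz /eqP oz] | ]; last by rewrite mulr0.
case/eqP: neq_z; apply: block_offset_inj; first by rewrite -bz.
by apply: succn_inj; rewrite -oz.
Qed.

Lemma mulmx_jordan_first w v :
  offset v = 0%N -> (A *m jordan_mx K P) w v = 0.
Proof.
move=> ov; rewrite mxE big1 // => z _.
by rewrite jordan_mxE /next_in_block ov andbF mulr0.
Qed.

Lemma jordan_mulmx_next u v w :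
  next_in_block u v -> (jordan_mx K P *m A) u w = A v w.
Proof.
move=> uv; rewrite mxE (bigD1 v) //= big1 => [|z neq_z].
  by rewrite jordan_mxE uv mul1r addr0.
have [/andP[/eqP bv /eqP ov]] := (uv); rewrite jordan_mxE.
case: (boolP (next_in_block u z)) => [/andP[/eqP bz /eqP oz] | ]; last by rewrite mul0r.
by case/eqP: neq_z; apply: block_offset_inj; rewrite ?bz ?oz.
Qed.

Lemma jordan_mulmx_last u w :
  (offset u).+1 = nth 0%N P (block u) -> (jordan_mx K P *m A) u w = 0.
Proof.
move=> last_u; rewrite mxE big1 // => z _.
rewrite jordan_mxE; case: (boolP (next_in_block u z)) => [/andP[/eqP bz /eqP oz] | ];
  last by rewrite mul0r.
by have := reshape_offsetP (ltn_ord z); rewrite bz oz last_u ltnn.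
Qed.

Hypothesis cAJ : comm_mx A (jordan_mx K P).

(** The entries of A are constant along the simultaneous steps to the previous
    vector in both blocks.  If the column index reaches the start of its block
    first, the entry is one of J *m A = A *m J in a zero column of J. *)
Lemma commutator_offset_le u v : A u v != 0 -> (offset u <= offset v)%N.
Proof.
rewrite leqNgt; apply: contra => lt_vu; apply/eqP.
move: {2}(offset v) (erefl (offset v)) => b ob.
elim: b u v ob lt_vu => [|b IHb] u v ob lt_vu;
  have [|u0 u0u] := @prev_exists u; try lia;
  rewrite -(jordan_mulmx_next _ u0u) -cAJ.
- exact: mulmx_jordan_first.
- have [|v0 v0v] := @prev_exists v; first by rewrite ob.
  rewrite (mulmx_jordan_next _ v0v); apply: IHb;
    by case/andP: u0u v0v => _ /eqP ? /andP[_ /eqP ?]; lia.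
Qed.

(** The mirror image of the previous bound: stepping towards the ends of both
    blocks, the row index must not reach its end first. *)
Lemma commutator_tail_le u v :
  A u v != 0 -> (nth 0 P (block v) + offset u <= nth 0 P (block u) + offset v)%N.
Proof.
rewrite leqNgt; apply: contra => lt_uv; apply/eqP.
have := reshape_offsetP (ltn_ord u); rewrite -subn_gt0.
move eq_d: (_ - _)%N => d; case: d eq_d => // d eq_d _.
elim: d u v eq_d lt_uv => [|d IHd] u v eq_d lt_uv;
  have [|v1 vv1] := @next_exists v; try lia;
  rewrite -(mulmx_jordan_next _ vv1) cAJ.
- by apply: jordan_mulmx_last; lia.
- have [|u1 uu1] := @next_exists u; first lia.
  rewrite (jordan_mulmx_next _ uu1).
  case/andP: (uu1) (vv1) => /eqP bu /eqP ou /andP[/eqP bv /eqP ov].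
  by apply: IHd; rewrite ?bu ?bv; lia.
Qed.

End JordanCommutator.

(** * Matrices that raise a degree *)

Section Graded.

Variables (K : fieldType) (n : nat) (deg : 'I_n -> nat).
Implicit Type A : 'M[K]_n.

Definition raises_degree k A :=
  forall u v, A u v != 0 -> (deg u + k <= deg v)%N.

Lemma raises_degree_exp A k : raises_degree 1 A -> raises_degree k (A ^+ k).
Proof.
move=> rA; elim: k => [|k IHk] u v.
  by rewrite expr0 mxE addn0; case: (u =P v) => [-> // | _]; rewrite eqxx.
apply: contraNleq => lt_v; rewrite exprS -mulmxE mxE big1 // => w _.
apply/eqP; rewrite mulf_eq0 -implyNb; apply/implyP => /rA le_uw.
by apply: contraTT lt_v => /IHk; lia.
Qed.

Lemma nilpotent_of_raises_degree A : raises_degree 1 A -> nilpotent_mx A.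
Proof.
move=> rA; exists (\max_u deg u).+1; apply/matrixP => u v; rewrite mxE.
apply/eqP; apply/negPn/negP => /(raises_degree_exp rA).
by have := leq_bigmax (F := deg) v; lia.
Qed.

(** The diagonal of a power of a triangular matrix consists of the powers of
    the diagonal entries, which thus vanish when the matrix is nilpotent. *)
Lemma nilpotent_triangular_raises_degree A :
    (forall u v, A u v != 0 -> u = v \/ (deg u < deg v)%N) ->
  nilpotent_mx A -> raises_degree 1 A.
Proof.
move=> triA [N AN].
have triX k : (forall u v, (A ^+ k) u v != 0 -> u = v \/ (deg u < deg v)%N)
              /\ forall u, (A ^+ k) u u = A u u ^+ k.
  elim: k => [|k [triAk diagAk]].
    split=> [u v|u]; rewrite !expr0 mxE ?eqxx //.
    by case: (u =P v) => [-> _ | _]; [left | rewrite eqxx].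
  rewrite exprS -mulmxE; split=> [u v | u].
    rewrite mxE => nz; have [w]: exists w, A u w * (A ^+ k) w v != 0.
      apply/existsP; apply: contraNT nz; rewrite negb_exists => /forallP z.
      by apply/eqP; rewrite big1 // => w _; have /negPn/eqP := z w.
    rewrite mulf_eq0 negb_or => /andP[/triA uw /triAk wv].
    case: uw wv => [-> // | lt_uw] [<- | lt_wv]; first by right.
    by right; apply: ltn_trans lt_wv.
  rewrite mxE (bigD1 u) //= big1 => [|w neq_w]; first by rewrite diagAk addr0 exprS.
  apply/eqP; rewrite mulf_eq0 -implyNb; apply/implyP => /triA[eq_uw | lt_uw].
    by rewrite eq_uw eqxx in neq_w.
  apply/negPn/negP => /triAk[eq_wu | lt_wu]; first by rewrite eq_wu eqxx in neq_w.
  by have := ltn_trans lt_uw lt_wu; rewrite ltnn.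
have diag0 u : A u u = 0.
  have [_ /(_ u)] := triX N; rewrite AN mxE => /esym/eqP.
  by rewrite expf_eq0 => /andP[_ /eqP].
move=> u v nz; rewrite addn1; case: (triA u v nz) => // eq_uv.
by rewrite eq_uv diag0 eqxx in nz.
Qed.

Lemma rank_coordinate_projection (S : pred 'I_n) :
  (\rank (\sum_(u | S u) delta_mx u u : 'M[K]_n)%R <= \sum_u S u)%N.
Proof.
rewrite big_mkcond; elim/big_rec2: _ => [|u M r _ le_rM]; first by rewrite mxrank0.
apply: leq_trans (mxrank_add _ _) (leq_add _ le_rM).
by case: (S u); rewrite ?mxrank_delta ?mxrank0.
Qed.

Lemma coordinate_projectionE (S : pred 'I_n) u v :
  (\sum_(w | S w) delta_mx w w : 'M[K]_n) u v = ((u == v) && S u)%:R.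
Proof.
rewrite summxE; have [Su | nSu] := boolP (S u); last first.
  rewrite andbF big1 // => w Sw; rewrite mxE; case: eqP => // eq_uw.
  by rewrite eq_uw Sw in nSu.
rewrite (bigD1 u) //= big1 => [|w /andP[_ /negPf neq]].
  by rewrite mxE eqxx addr0 andbT eq_sym.
by rewrite mxE eq_sym neq.
Qed.

(** The rows of degree at least d are supported on the columns of degree at
    least d + k, so A is the sum of a matrix with few rows and one with few
    columns. *)
Lemma rank_raises_degree_le A k d :
    raises_degree k A ->
  (\rank A <= \sum_u (deg u < d) + \sum_v (d + k <= deg v))%N.
Proof.
move=> rA.
pose S : 'M[K]_n := \sum_(u | (deg u < d)%N) delta_mx u u.
pose T : 'M[K]_n := \sum_(v | (d + k <= deg v)%N) delta_mx v v.
have -> : A = S *m A + (1%:M - S) *m A *m T.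
  have SA u v : (S *m A) u v = if (deg u < d)%N then A u v else 0.
    rewrite mxE (bigD1 u) //= big1 => [|w /negPf neq].
      by rewrite coordinate_projectionE eqxx addr0; case: ltnP; rewrite ?mul1r ?mul0r.
    by rewrite coordinate_projectionE eq_sym neq mul0r.
  have AT M u v : (M *m T) u v = if (d + k <= deg v)%N then M u v else 0.
    rewrite mxE (bigD1 v) //= big1 => [|w /negPf neq].
      by rewrite coordinate_projectionE eqxx addr0; case: leqP; rewrite ?mulr1 ?mulr0.
    by rewrite coordinate_projectionE neq mulr0.
  apply/matrixP => u v; rewrite mxE AT mulmxBl mul1mx.
  have -> : (A - S *m A) u v = A u v - (S *m A) u v by rewrite !mxE.
  rewrite !SA.
  case: ltnP => [_ | le_du]; first by rewrite subrr if_same addr0.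
  rewrite subr0 add0r; case: leqP => // lt_v; apply/eqP; apply: contraTT lt_v.
  by move/rA; lia.
apply: leq_trans (mxrank_add _ _) (leq_add _ _).
  by apply: leq_trans (mxrankM_maxl _ _) _; apply: rank_coordinate_projection.
by apply: leq_trans (mxrankM_maxr _ _) _; apply: rank_coordinate_projection.
Qed.

End Graded.

(** * Partitions whose parts differ by at least two *)

Section Stable.

Variables (K : fieldType) (P : seq nat).
Implicit Types u v w : 'I_(sumn P).

Hypothesis posP : all (leq 1) P.
Hypothesis gapP :
  forall u : nat, (u.+1 < size P)%N -> (2 <= nth 0 P u - nth 0 P u.+1)%N.

Local Notation block u := (reshape_index P u).
Local Notation offset u := (reshape_offset P u).

(** For a matrix commuting with the Jordan matrix, a nonzero entry from block i
    to block j increases this degree by at least j - i >= 1 if i < j, and, since the offset must grow by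
    p_j - p_i >= 2 (i - j), by at least i - j >= 1 if j < i. *)
Definition string_degree (u : 'I_(sumn P)) := (block u + offset u)%N.

Lemma gap_nth i j : (i <= j < size P)%N ->
  (nth 0 P j + 2 * (j - i) <= nth 0 P i)%N.
Proof.
case/andP; elim: j => [|j IHj]; first by rewrite leqn0 => /eqP ->; lia.
rewrite leq_eqVlt => /predU1P[-> | lt_ij] lt_j; first lia.
by have := IHj lt_ij (ltnW lt_j); have := gapP lt_j; lia.
Qed.

Lemma nilpotent_commutator_raises_degree (A : 'M[K]_(sumn P)) :
  nilpotent_commutator (jordan_mx K P) A -> raises_degree string_degree 1 A.
Proof.
case=> nA cA; apply: nilpotent_triangular_raises_degree => // u v nz.
have := commutator_offset_le cA nz; have := commutator_tail_le cA nz.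
have := reshape_indexP (ltn_ord u); have := reshape_indexP (ltn_ord v).
rewrite /string_degree => lt_v lt_u le_tail le_off.
have [lt_uv | lt_vu | eq_uv] := ltngtP (block u) (block v).
- by right; lia.
- by right; have := @gap_nth (block v) (block u); rewrite ltnW ?lt_u //; lia.
have [eq_off | neq_off] := eqVneq (offset u) (offset v).
  by left; apply: block_offset_inj.
by right; lia.
Qed.

Lemma nilpotent_commutator_line (A B : 'M[K]_(sumn P)) s :
    nilpotent_commutator (jordan_mx K P) A ->
    nilpotent_commutator (jordan_mx K P) B ->
  nilpotent_commutator (jordan_mx K P) (A + s *: (B - A)).
Proof.
move=> NA NB; split; last first.
  case: NA NB => _ cA [_ cB].
  by rewrite /comm_mx mulmxDl mulmxDr -scalemxAl -scalemxAr mulmxBl mulmxBr cA cB.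
apply: (@nilpotent_of_raises_degree _ _ string_degree) => u v.
have rA := nilpotent_commutator_raises_degree NA.
have rB := nilpotent_commutator_raises_degree NB.
apply: contraNleq => lt_v; rewrite !mxE.
have -> : A u v = 0 by apply/eqP; apply: contraTT lt_v => /rA; rewrite -leqNgt.
have -> : B u v = 0 by apply/eqP; apply: contraTT lt_v => /rB; rewrite -leqNgt.
by rewrite subr0 mulr0 addr0.
Qed.

Lemma sum_ord_ltn p x : (\sum_(a < p) (a < x) = minn p x)%N.
Proof.
elim: p => [|p IHp]; first by rewrite big_ord0 min0n.
by rewrite big_ord_recr /= IHp; case: (ltnP p x); lia.
Qed.

Lemma sum_ord_geq p x : (\sum_(a < p) (x <= a) = p - x)%N.
Proof.
elim: p => [|p IHp]; first by rewrite big_ord0.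
by rewrite big_ord_recr /= IHp; case: (leqP x p); lia.
Qed.

(** Block j occupies the degrees from j to j + p_j - 1.  Cutting at the number
    d of parts larger than k makes the bound by rows and columns exact: a part
    larger than k contributes d - j rows and j + p_j - (d + k) columns, in
    total p_j - k, while the other parts contribute nothing. *)
Lemma nilpotent_commutator_rank_le (A : 'M[K]_(sumn P)) k :
  nilpotent_commutator (jordan_mx K P) A ->
  (\rank (A ^+ k) <= sumn [seq (p - k)%N | p <- P])%N.
Proof.
move/nilpotent_commutator_raises_degree/(raises_degree_exp (k := k)) => rAk.
(* P is decreasing, so this index is the number of parts larger than k. *)
pose d := find (fun p => p <= k)%N P.
apply: leq_trans (rank_raises_degree_le d rAk) _.
rewrite -big_split /string_degree /=.
rewrite (sum_block_offset P (fun j a => (j + a < d) + (d + k <= j + a))%N).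
rewrite sumnE big_map (big_nth 0%N) big_mkord leq_eqVlt; apply/orP; left; apply/eqP.
apply: eq_bigr => j _; set p := nth 0%N P j; rewrite big_split /=.
have -> : (\sum_(a < p) (j + a < d) = minn p (d - j))%N.
  by rewrite -sum_ord_ltn; apply: eq_bigr => a _; rewrite ltn_subRL.
have -> : (\sum_(a < p) (d + k <= j + a) = p - (d + k - j))%N.
  by rewrite -sum_ord_geq; apply: eq_bigr => a _; rewrite leq_subLR.
have lt_j := ltn_ord j; have [lt_jd | le_dj] := ltnP j d.
  have le_d : (d <= size P)%N := find_size _ _.
  have := @before_find _ 0%N (fun p => p <= k)%N P d.-1; rewrite -/d.
  have := @gap_nth j d.-1; rewrite -/p; lia.
have lt_d : (d < size P)%N := leq_ltn_trans le_dj lt_j.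
have := @nth_find _ 0%N (fun p => p <= k)%N P; rewrite has_find -/d lt_d => /(_ isT).
have := @gap_nth d j; rewrite -/p; lia.
Qed.

Lemma sorted_of_gaps : sorted geq P.
Proof. by apply/(sortedP 0%N) => i /gapP /=; lia. Qed.

Lemma stable_Q_is : infinite_type K -> Q_is K P P.
Proof.
move=> infK; pose J := jordan_mx K P; pose N := nilpotent_commutator J.
have NJ : N J.
  split=> //; exists (sumn P); apply/eqP.
  by rewrite -mxrank_eq0 rank_jordan_mx_exp sumn_map_subn_eq0 ?all_leq_sumn.
have [f fJ fP] := rank_exps_lower_semicontinuous J (sumn P).
exists (fun A => N A /\ entries_eval f A != 0); split.
- exact: zariski_open_nonvanishing.
- apply: zariski_dense_nonvanishing fJ => // A B s.
  exact: nilpotent_commutator_line.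
move=> A [NA fA]; split; first by split=> //; apply: sorted_of_gaps.
exists erefl; rewrite castmx_id.
have [|S uS SA] := @jordan_form_of_ranks K P A sorted_of_gaps posP.
  move=> k; apply/eqP; rewrite eqn_leq nilpotent_commutator_rank_le //=.
  rewrite -(rank_jordan_mx_exp K).
  have [lt_k | le_k] := ltnP k (sumn P); first exact: fP.
  rewrite rank_jordan_mx_exp sumn_map_subn_eq0 //.
  by apply: sub_all (all_leq_sumn P) => p /leq_trans; apply.
by exists S => //; apply/similarP.
Qed.

End Stable.

Theorem theorem1p12 (K : fieldType) (hK : infinite_type K) (n : nat)
    (hn : (0 < n)%N) (P : seq nat) (hP : is_partition_of n P) :
  ((forall u : nat, (u.+1 < size P)%N ->
      (2 <= nth 0%N P u - nth 0%N P u.+1)%N)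
   <-> Q_is K P P)
  /\ (Q_is K P P
      <-> exists2 c : nat, (0 < c)%N &
            Q_is K (repeat_parts c P) [seq (c * p)%N | p <- P]).
Proof.
have [sP posP _] := hP; have partP : is_partition_of (sumn P) P by split.
have one_copy : Q_is K P P <-> Q_is K (repeat_parts 1 P) [seq (1 * p)%N | p <- P].
  rewrite /repeat_parts (flatten_map1 id) map_id.
  by rewrite (eq_map mul1n) map_id.
have stable : (forall u : nat, (u.+1 < size P)%N ->
    (2 <= nth 0%N P u - nth 0%N P u.+1)%N) -> Q_is K P P.
  by move=> gapP; apply: stable_Q_is.
split; split.
- exact: stable.
- by move/one_copy; apply: parts_differ_of_Q_is.
- by move=> QP; exists 1%N => //; apply/one_copy.
- by case=> c c_gt0 QcP; apply: stable; apply: parts_differ_of_Q_is QcP.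
Qed.
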